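(* Consider the linear structural equation model described in the context. Suppose that either Assumption A or Assumption A$'$ holds. If $\beta_{X\to Y}\beta_{Y\to X}=0$, then $(\beta_{X\to Y},\beta_{Y\to X})$ is identifiable, i.e. uniquely determined by the joint distribution of the observed variables $(X_i,Y_i,Z_i)$.
   Context: Observations $(X_i,Y_i,Z_i,U_i)$, $i=1,\dots,n$, are i.i.d.; $X_i,Y_i\in\mathbb{R}$ are observed with finite variance, $Z_i\in\mathbb{R}^p$ is an observed vector of candidate instruments, $U_i$ is unobserved. Assume $E(X_i)=E(Y_i)=0$, $E(Z_i)=0$, and $\Sigma=E(Z_iZ_i^{T})$ invertible. The data satisfy $$Y_i=\beta_{X\to Y}X_i+\pi_Y^{T}Z_i+\xi_Y(U_i)+\zeta_i,\qquad X_i=\beta_{Y\to X}Y_i+\pi_X^{T}Z_i+\xi_X(U_i)+\eta_i,$$ with $\pi_X,\pi_Y\in\mathbb{R}^p$, mean-zero functions $\xi_Y(U_i),\xi_X(U_i)$, $Z_i$ independent of $U_i$, and $E(\zeta_i\mid\eta_i,Z_i,U_i)=E(\eta_i\mid\zeta_i,Z_i,U_i)=0$. The matrix $B=\begin{pmatrix}0&\beta_{X\to Y}\\ \beta_{Y\to X}&0\end{pmatrix}$ has spectral norm $<1$, and $(Y_i,X_i)^T=(I-B)^{-1}\{(\pi_Y^TZ_i,\pi_X^TZ_i)^T+(R_{Y,i},R_{X,i})^T\}$ where $R_{Y,i}=\xi_Y(U_i)+\zeta_i$, $R_{X,i}=\xi_X(U_i)+\eta_i$. Then $E(Y_i\mid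 Z_i)=\gamma_Y^TZ_i$, $E(X_i\mid Z_i)=\gamma_X^TZ_i$ with $\gamma_Y=(\pi_Y+\beta_{X\to Y}\pi_X)/(1-\beta_{X\to Y}\beta_{Y\to X})$, $\gamma_X=(\pi_X+\beta_{Y\to X}\pi_Y)/(1-\beta_{X\to Y}\beta_{Y\to X})$. Sets: $\mathcal{V}_{X\to Y}=\{j:\pi_{X,j}\neq0,\pi_{Y,j}=0\}$, $\mathcal{V}_{Y\to X}=\{j:\pi_{Y,j}\neq0,\pi_{X,j}=0\}$, $\mathcal{V}_{pl}=\{j:\pi_{X,j}\neq0,\pi_{Y,j}\neq0\}$, $\mathcal{S}_X=\{j:\gamma_{X,j}\neq0\}$, $\mathcal{S}_Y=\{j:\gamma_{Y,j}\neq0\}$. Maxima over empty collections are $0$; $\mathbb{1}$ is the indicator. Assumption A: $|\mathcal{V}_{X\to Y}|>\max\big(\max_c|\{j\in\mathcal{V}_{pl}\cap\mathcal{S}_X:\pi_{Y,j}/\gamma_{X,j}=c\}|,\ |\mathcal{V}_{Y\to X}|\mathbb{1}(\beta_{Y\to X}\neq0),\ |\mathcal{V}_{pl}\setminus\mathcal{S}_X|\mathbb{1}(\beta_{Y\to X}\neq0)\big)$, and $\mathrm{Cov}(Y_iR_{Y,i},Z_i)\neq0$. Assumption A$'$: $|\mathcal{V}_{Y\to X}|>\max\big(\max_c|\{j\in\mathcal{V}_{pl}\cap\mathcal{S}_Y:\pi_{X,j}/\gamma_{Y,j}=c\}|,\ |\mathcal{V}_{X\to Y}|\mathbb{1}(\beta_{X\to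 Y}\neq0),\ |\mathcal{V}_{pl}\setminus\mathcal{S}_Y|\mathbb{1}(\beta_{X\to Y}\neq0)\big)$, and $\mathrm{Cov}(X_iR_{X,i},Z_i)\neq0$. *)

(* Defs.v *)
From HB Require Import structures.
From mathcomp Require Import all_boot all_order all_algebra.
From mathcomp Require Import all_classical all_reals all_analysis.
Set Implicit Arguments. Unset Strict Implicit. Unset Printing Implicit Defensive.
Import Order.TTheory GRing.Theory Num.Theory.
Local Open Scope classical_set_scope.
Local Open Scope ring_scope.

(* One observation (X,Y,Z,U) of the linear SEM, together with the     *)
(* structural parameters.  Since the sample is i.i.d., the model (and *)
(* the joint law of the observed variables) is that of one draw.      *)
Record SEM (R : realType) (p : nat) := MkSEM {
  dT : measure_display;
  T : measurableType dT;
  P : probability T R;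
  dU : measure_display;
  UT : measurableType dU;
  X : T -> R;
  Y : T -> R;
  Z : 'I_p -> T -> R;
  U : T -> UT;
  zeta : T -> R;
  eta : T -> R;
  bXY : R;
  bYX : R;
  piX : 'I_p -> R;
  piY : 'I_p -> R;
  xiY : UT -> R;
  xiX : UT -> R }.

Arguments dT {R p}. Arguments T {R p}. Arguments P {R p}. Arguments dU {R p}.
Arguments UT {R p}. Arguments X {R p}. Arguments Y {R p}. Arguments Z {R p}.
Arguments U {R p}. Arguments zeta {R p}. Arguments eta {R p}.
Arguments bXY {R p}. Arguments bYX {R p}. Arguments piX {R p}. Arguments piY {R p}.
Arguments xiY {R p}. Arguments xiX {R p}.

Section defs.
Context {R : realType}.

Definition rv_sets {T0 : Type} (f : T0 -> R) : set (set T0) :=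
  [set f @^-1` A | A in [set A : set R | measurable A]].

Definition gen_sigma {T0 : Type} (G : set (set T0)) : set (set T0) := <<s G >>.

Definition l2norm (n : nat) (v : 'cV[R]_n) : R := Num.sqrt (\sum_i v i 0 ^+ 2).
Definition spec_norm (m n : nat) (B : 'M[R]_(m, n)) : R :=
  sup [set l2norm (B *m v) | v in [set v : 'cV[R]_n | l2norm v = 1]].

Definition integrableR {d} {T0 : measurableType d} (Pr : probability T0 R)
  (f : T0 -> R) : Prop := Pr.-integrable setT (EFin \o f).

Definition indep_sigma {d} {T0 : measurableType d} (Pr : probability T0 R)
  (G1 G2 : set (set T0)) : Prop :=
  forall A B, G1 A -> G2 B -> Pr (A `&` B) = (Pr A * Pr B)%E.

Definition cond_exp_zero {d} {T0 : measurableType d} (Pr : probability T0 R)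
  (f : T0 -> R) (G : set (set T0)) : Prop :=
  integrableR Pr f /\ forall A, G A -> (\int[Pr]_(w in A) (f w)%:E)%E = 0%E.

End defs.

Section model.
Context {R : realType} {p : nat} (M : SEM R p).

Definition RY (w : T M) : R := xiY M (U M w) + zeta M w.
Definition RX (w : T M) : R := xiX M (U M w) + eta M w.

Definition sigmaZ : set (set (T M)) := gen_sigma (\bigcup_(j in setT) rv_sets (Z M j)).
Definition sigmaU : set (set (T M)) :=
  gen_sigma [set U M @^-1` B | B in [set B : set (UT M) | measurable B]].
Definition sigma_etaZU : set (set (T M)) :=
  gen_sigma (rv_sets (eta M) `|` (\bigcup_(j in setT) rv_sets (Z M j))
             `|` [set U M @^-1` B | B in [set B : set (UT M) | measurable B]]).
Definition sigma_zetaZU : set (set (T M)) :=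
  gen_sigma (rv_sets (zeta M) `|` (\bigcup_(j in setT) rv_sets (Z M j))
             `|` [set U M @^-1` B | B in [set B : set (UT M) | measurable B]]).

Definition Bmat : 'M[R]_2 :=
  \matrix_(i < 2, j < 2)
    (if (val i == 0%N) && (val j == 1%N) then bXY M
     else if (val i == 1%N) && (val j == 0%N) then bYX M else 0).

Definition Sigma : 'M[R]_p :=
  \matrix_(j < p, k < p) fine ('E_(P M)[fun w => (Z M j w * Z M k w)%R])%E.

Definition valid_model : Prop :=
  [/\ [/\ measurable_fun setT (X M), measurable_fun setT (Y M),
          (forall j, measurable_fun setT (Z M j)), measurable_fun setT (U M)
        & [/\ measurable_fun setT (zeta M), measurable_fun setT (eta M),
              measurable_fun setT (xiY M) & measurable_fun setT (xiX M)]],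
      [/\ integrableR (P M) (fun w => X M w ^+ 2),
          integrableR (P M) (fun w => Y M w ^+ 2),
          ('E_(P M)[X M] = 0)%E & ('E_(P M)[Y M] = 0)%E]
      & [/\ forall j, integrableR (P M) (fun w => Z M j w ^+ 2),
          forall j, ('E_(P M)[Z M j] = 0)%E
        & Sigma \in unitmx]] /\ [/\
      (forall w, Y M w = bXY M * X M w + \sum_j piY M j * Z M j w
                         + xiY M (U M w) + zeta M w) /\
      (forall w, X M w = bYX M * Y M w + \sum_j piX M j * Z M j w
                         + xiX M (U M w) + eta M w),
      [/\ integrableR (P M) (xiY M \o U M), ('E_(P M)[xiY M \o U M] = 0)%E,
          integrableR (P M) (xiX M \o U M), ('E_(P M)[xiX M \o U M] = 0)%E
        & indep_sigma (P M) sigmaZ sigmaU],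
      cond_exp_zero (P M) (zeta M) sigma_etaZU /\
      cond_exp_zero (P M) (eta M) sigma_zetaZU
    & spec_norm Bmat < 1].

Definition gammaX (j : 'I_p) : R :=
  (piX M j + bYX M * piY M j) / (1 - bXY M * bYX M).
Definition gammaY (j : 'I_p) : R :=
  (piY M j + bXY M * piX M j) / (1 - bXY M * bYX M).

Definition V_XY : {set 'I_p} := [set j | (piX M j != 0) && (piY M j == 0)].
Definition V_YX : {set 'I_p} := [set j | (piY M j != 0) && (piX M j == 0)].
Definition V_pl : {set 'I_p} := [set j | (piX M j != 0) && (piY M j != 0)].
Definition S_X : {set 'I_p} := [set j | gammaX j != 0].
Definition S_Y : {set 'I_p} := [set j | gammaY j != 0].

Definition cov_vec_nonzero (W : T M -> R) : Prop :=
  [/\ integrableR (P M) W, forall j, integrableR (P M) (fun w => W w * Z M j w)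
    & exists j, covariance (P M) W (Z M j) != 0%E].

(* |V| > max(a,b,c) is written as the three strict inequalities;
   |V| > max_c f(c) is written as forall c, f(c) < |V|. *)
Definition assumptionA : Prop :=
  [/\ forall c : R,
        (#|[set j in V_pl :&: S_X | piY M j / gammaX j == c]| < #|V_XY|)%N,
      (#|V_YX| * (bYX M != 0%R) < #|V_XY|)%N,
      (#|V_pl :\: S_X| * (bYX M != 0%R) < #|V_XY|)%N
    & cov_vec_nonzero (fun w => Y M w * RY w)].

Definition assumptionA' : Prop :=
  [/\ forall c : R,
        (#|[set j in V_pl :&: S_Y | piX M j / gammaY j == c]| < #|V_YX|)%N,
      (#|V_XY| * (bXY M != 0%R) < #|V_YX|)%N,
      (#|V_pl :\: S_Y| * (bXY M != 0%R) < #|V_YX|)%N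
    & cov_vec_nonzero (fun w => X M w * RX w)].

Definition obs (w : T M) : R * R * ('I_p -> R) := (X M w, Y M w, fun j => Z M j w).

End model.
Arguments obs {R p} M w.
Arguments RY {R p} M w.
Arguments RX {R p} M w.

Definition obs_sigma {R : realType} {p : nat} : set (set (R * R * ('I_p -> R))) :=
  gen_sigma (rv_sets (fun o : R * R * ('I_p -> R) => o.1.1)
             `|` rv_sets (fun o : R * R * ('I_p -> R) => o.1.2)
             `|` \bigcup_(j in [set: 'I_p]) rv_sets (fun o : R * R * ('I_p -> R) => o.2 j)).

Definition same_obs_law {R : realType} {p : nat} (M1 M2 : SEM R p) : Prop :=
  forall S, obs_sigma S -> P M1 (obs M1 @^-1` S) = P M2 (obs M2 @^-1` S).

(* Main.v *)
Require Import Defs.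
From HB Require Import structures.
From mathcomp Require Import all_boot all_order all_algebra perm.
From mathcomp Require Import all_classical all_reals all_analysis.
From mathcomp Require Import measurable_realfun ring lra.
Import Order.TTheory GRing.Theory Num.Theory.
Import numFieldNormedType.Exports.
Local Open Scope ring_scope.
Local Open Scope classical_set_scope.

(* Write b, c for the two effects (b c = 0), e_X = X - gamma_X^T Z and
   e_Y = Y - gamma_Y^T Z.  Regression on Z identifies gamma_X and gamma_Y, hence
   the law of (e_X, e_Y, Z), and R_Y = e_Y - b e_X, R_X = e_X - c e_Y.  As
   E(R_X R_Y | Z) is constant, for every event A of sigma(Z), with
   w = 1_A - P(A),
     E(e_X e_Y w) = c E(e_Y^2 w) + b E(e_X^2 w),
   and under Assumption A some A has E(e_Y^2 w) <> b E(e_X e_Y w).  Testing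
   against w instead of Z avoids all questions of integrability of third
   moments.  Moreover, under Assumption A, b is the strict mode of the ratios
   gamma_Y,j / gamma_X,j.  When A holds in both models this gives b, and then
   c from the moment relation; A' is A with X and Y exchanged.  When A holds in one and A' in the other, the
   only delicate case is b <> 0 in the first model and c <> 0 in the second:
   the modes force b = 1 / c, and the two moment relations together
   contradict E(e_Y^2 w) <> b E(e_X e_Y w). *)

(** * Expectations and sub-sigma-algebras *)

Section moments.
Context {d} {T : measurableType d} {R : realType} (Pr : probability T R).
Implicit Types (f g h w : T -> R) (A : set T).

(** The ascription re-equips [T] with the sigma-algebra generated by [G], so general results on
    measurable functions apply to sub-sigma-algebras. *)
Definition meas_wrt (G : set (set T)) (h : T -> R) :=
  measurable_fun setT (h : g_sigma_algebraType G -> R).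

Definition L2 f := measurable_fun setT f /\ integrableR Pr (fun x => f x ^+ 2).

Lemma integrableR_measurable f : integrableR Pr f -> measurable_fun setT f.
Proof. by move=> /(measurable_int Pr) /measurable_EFinP. Qed.

Lemma integrableR_le f g : measurable_fun setT f -> integrableR Pr g ->
  (forall x, `|f x| <= `|g x|) -> integrableR Pr f.
Proof.
move=> mf ig fg; apply: (le_integrable measurableT _ _ ig).
  exact/measurable_EFinP.
by move=> x _ /=; rewrite lee_fin.
Qed.

Lemma integrableRD f g : integrableR Pr f -> integrableR Pr g ->
  integrableR Pr (fun x => f x + g x).
Proof. by move=> If Ig; have := integrableD measurableT If Ig. Qed.

Lemma integrableRB f g : integrableR Pr f -> integrableR Pr g ->
  integrableR Pr (fun x => f x - g x).
Proof. by move=> If Ig; have := integrableB measurableT If Ig. Qed.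

Lemma integrableRZ k f : integrableR Pr f -> integrableR Pr (fun x => k * f x).
Proof. by move=> If; have := integrableZl measurableT k If. Qed.

Lemma integrableR_bounded f w (K : R) : integrableR Pr f ->
  measurable_fun setT w -> (forall x, `|w x| <= K) ->
  integrableR Pr (fun x => f x * w x).
Proof.
move=> /[dup] /integrableR_measurable mf If mw wK.
apply: (@integrableR_le _ (fun x => K * f x)).
- exact: measurable_funM.
- exact: integrableRZ.
- move=> x; rewrite !normrM mulrC ler_wpM2r//.
  exact: le_trans (wK x) (ler_norm _).
Qed.

Lemma integrableR_bounded_l f w (K : R) : integrableR Pr f ->
  measurable_fun setT w -> (forall x, `|w x| <= K) ->
  integrableR Pr (fun x => w x * f x).
Proof.
move=> If mw wK; rewrite (_ : (fun x => _) = fun x => f x * w x).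
  exact: integrableR_bounded If mw wK.
by apply/funext => x; rewrite mulrC.
Qed.

Lemma integrableR_cst k : integrableR Pr (fun=> k).
Proof. by apply: finite_measure_integrable_cst. Qed.

Lemma L2M f g : L2 f -> L2 g -> integrableR Pr (fun x => f x * g x).
Proof.
move=> [mf If] [mg Ig].
apply: (@integrableR_le _ (fun x => f x ^+ 2 + g x ^+ 2)).
- exact: measurable_funM.
- exact: integrableRD.
- move=> x; rewrite [leRHS]ger0_norm ?addr_ge0 ?sqr_ge0// ler_norml.
  have := sqr_ge0 (f x + g x); have := sqr_ge0 (f x - g x).
  have := sqr_ge0 (f x); have := sqr_ge0 (g x); rewrite !expr2; nra.
Qed.

Lemma L2Z k f : L2 f -> L2 (fun x => k * f x).
Proof.
move=> [mf If]; split; first exact: measurable_funM.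
rewrite (_ : (fun x => _) = fun x => k ^+ 2 * f x ^+ 2); first exact: integrableRZ.
by apply/funext => x; rewrite exprMn.
Qed.

Lemma L2D f g : L2 f -> L2 g -> L2 (fun x => f x + g x).
Proof.
move=> Hf Hg; split; first by apply: measurable_funD; [case: Hf|case: Hg].
rewrite (_ : (fun x => _) =
  fun x => f x ^+ 2 + 2 * (f x * g x) + g x ^+ 2); last first.
  by apply/funext => x; ring.
apply: integrableRD; last by case: Hg.
apply: integrableRD; first by case: Hf.
exact/integrableRZ/L2M.
Qed.

Lemma L2B f g : L2 f -> L2 g -> L2 (fun x => f x - g x).
Proof.
move=> Hf /(L2Z (-1)) /(L2D _ _ Hf).
by congr L2; apply/funext => x; rewrite mulN1r.
Qed.

Lemma L2_cst k : L2 (fun=> k).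
Proof. by split; [exact: measurable_cst|exact: integrableR_cst]. Qed.

Lemma L2_sum (I : finType) (F : I -> T -> R) : (forall i, L2 (F i)) ->
  L2 (fun x => \sum_i F i x).
Proof.
move=> HF; rewrite (_ : (fun x => _) = \sum_i F i); last first.
  by apply/funext => x; rewrite fct_sumE.
apply: (big_ind L2) => //; first exact: L2_cst.
by move=> f g; exact: L2D.
Qed.

Lemma L2_integrable f : L2 f -> integrableR Pr f.
Proof.
move=> /L2M/(_ (L2_cst 1)); congr integrableR.
by apply/funext => x; rewrite mulr1.
Qed.

Lemma RexpD f g : integrableR Pr f -> integrableR Pr g ->
  \int[Pr]_x (f x + g x) = \int[Pr]_x f x + \int[Pr]_x g x.
Proof. exact: RintegralD. Qed.

Lemma RexpB f g : integrableR Pr f -> integrableR Pr g ->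
  \int[Pr]_x (f x - g x) = \int[Pr]_x f x - \int[Pr]_x g x.
Proof. exact: RintegralB. Qed.

Lemma RexpZ k f : integrableR Pr f ->
  \int[Pr]_x (k * f x) = k * \int[Pr]_x f x.
Proof. exact: RintegralZl. Qed.

Lemma integrableR_sum (I : finType) (F : I -> T -> R) :
  (forall i, integrableR Pr (F i)) -> integrableR Pr (fun x => \sum_i F i x).
Proof.
move=> HF; rewrite (_ : (fun x => _) = \sum_i F i); last first.
  by apply/funext => x; rewrite fct_sumE.
apply: (big_ind (integrableR Pr)) => //; first exact: integrableR_cst.
by move=> f g; exact: integrableRD.
Qed.

Lemma Rexp_sum (I : finType) (F : I -> T -> R) :
  (forall i, integrableR Pr (F i)) ->
  \int[Pr]_x (\sum_i F i x) = \sum_i \int[Pr]_x F i x.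
Proof.
move=> HF; rewrite /Rintegral.
under eq_integral do rewrite -sumEFin.
rewrite integral_sum//.
by rewrite sum_fine// => i _; apply: integrable_fin_num => //; exact: HF.
Qed.

Lemma meas_wrtS (G : set (set T)) h :
  (forall A, G A -> measurable A) -> meas_wrt G h -> measurable_fun setT h.
Proof.
move=> GM mh _ B mB; have := mh measurableT B mB.
apply: smallest_sub; last exact: GM.
exact: sigma_algebra_measurable.
Qed.

(** Dominated convergence for vanishing integrals; it serves both to pass from simple to measurable
    functions and to remove a truncation. *)
Lemma dominated_Rexp (F : nat -> T -> R) f g :
  (forall n, measurable_fun setT (F n)) -> measurable_fun setT f ->
  (forall x, F ^~ x @ \oo --> f x) -> integrableR Pr g ->
  (forall n x, `|F n x| <= g x) ->
  (forall n, \int[Pr]_x F n x = 0) -> \int[Pr]_x f x = 0.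
Proof.
move=> mF mf Ff Ig Fg F0.
have IF n : integrableR Pr (F n).
  apply: (integrableR_le _ _ (mF n) Ig) => x.
  exact: le_trans (Fg n x) (ler_norm _).
have [|||||_ _] := @dominated_convergence _ _ _ Pr _ measurableT
  (fun n => EFin \o F n) (EFin \o f) (EFin \o g).
- by move=> n; exact/measurable_EFinP.
- exact/measurable_EFinP.
- by apply: aeW => x _; apply: cvg_EFin; [exact: nearW|exact: Ff].
- exact: Ig.
- by apply: aeW => x n _ /=; rewrite lee_fin.
rewrite (_ : (fun n => _) = cst 0%E); last first.
  apply/funext => n /=; have := F0 n; rewrite /Rintegral => h.
  rewrite -[LHS]fineK; first by rewrite h.
  by apply: integrable_fin_num => //; exact: (IF n).
by move=> /(cvg_lim (@ereal_hausdorff R)); rewrite lim_cst// /Rintegral /= => <-.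
Qed.

Import HBSimple HBNNSimple.
(** The hypothesis on [f] says E(f | G) = 0. It gives the claim for indicators, hence for simple
    functions; [|f h|] then dominates the approximation of [h], so integrability is asked of the
    product. *)
Lemma pull_out (G : set (set T)) f h :
  (forall A, G A -> measurable A) -> integrableR Pr f ->
  (forall A, <<s G >> A -> \int[Pr]_x (f x * \1_A x) = 0) ->
  meas_wrt G h -> integrableR Pr (fun x => f x * h x) ->
  \int[Pr]_x (f x * h x) = 0.
Proof.
move=> GM If f0.
have GMs A : <<s G >> A -> measurable A.
  by apply: smallest_sub; [exact: sigma_algebra_measurable|exact: GM].
have indm A : <<s G >> A -> measurable_fun setT (\1_A : T -> R).
  by move=> /GMs; exact: measurable_indic.
(* Both parts of [h] stay measurable for [G], and their products with [f] are dominated by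
   [|f h|]. *)
wlog h0 : h / forall x, 0 <= h x => [hwlog mh Ifh|mh Ifh].
  have mhT := meas_wrtS _ _ GM mh.
  have Ip : integrableR Pr (fun x => f x * h^\+ x).
    apply: (integrableR_le _ _ _ Ifh).
      apply: measurable_funM; first exact: integrableR_measurable.
      exact: measurable_funrpos.
    move=> x; rewrite !normrM ler_wpM2l// /funrpos.
    by rewrite ger0_norm ?le_max ?lexx ?orbT// ge_max ler_norm normr_ge0.
  have In : integrableR Pr (fun x => f x * h^\- x).
    apply: (integrableR_le _ _ _ Ifh).
      apply: measurable_funM; first exact: integrableR_measurable.
      exact: measurable_funrneg.
    move=> x; rewrite !normrM ler_wpM2l// /funrneg.
    by rewrite ger0_norm ?le_max ?lexx ?orbT// ge_max -normrN ler_norm normr_ge0.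
  have -> : \int[Pr]_x (f x * h x) =
    \int[Pr]_x (f x * h^\+ x - f x * h^\- x).
    apply: eq_Rintegral => x _; rewrite -mulrBr; congr (_ * _).
    exact: (congr1 (@^~ x) (esym (funrposBneg h))).
  rewrite RexpB// [X in X - _]hwlog ?[X in _ - X]hwlog ?subrr//.
  - exact: measurable_funrneg.
  - exact: measurable_funrpos.
have mEh : measurable_fun setT (EFin \o h : g_sigma_algebraType G -> \bar R).
  exact/measurable_EFinP.
(* The approximation lives on the sigma-algebra of [G], so the level sets of [s n] are events of
   [<<s G >>]. *)
pose s := nnsfun_approx measurableT mEh.
have ms n : meas_wrt G (s n) by exact: measurable_funP.
have mf := integrableR_measurable _ If.
apply: (@dominated_Rexp (fun n x => f x * s n x) _ (fun x => `|f x * h x|)).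
- by move=> n; apply: measurable_funM => //; exact: meas_wrtS (ms n).
- exact: integrableR_measurable.
- move=> x; apply: cvgMl_tmp.
  have /fine_cvgP[_] := @cvg_nnsfun_approx _ _ _ _ measurableT _ mEh
    (fun x _ => (h0 x : (0 <= (h x)%:E)%E)) x Logic.I.
  exact.
- exact: integrable_norm.
- move=> n x; rewrite !normrM ler_wpM2l// !ger0_norm//.
  rewrite -lee_fin /s nnsfun_approxE.
  by apply: (@le_approx _ _ _ setT (EFin \o h)) => // y _; rewrite /= lee_fin.
- move=> n.
  pose r := finmap.enum_fset (fset_set (range (s n))).
  transitivity (\int[Pr]_x (\sum_(i < size r)
      (r`_i * (f x * \1_(s n @^-1` [set r`_i]) x)))).
    apply: eq_Rintegral => x _; rewrite {1}(fimfunEord (s n)) mulr_sumr.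
    by apply: eq_bigr => i _; rewrite mulrCA.
  have sG y : <<s G >> (s n @^-1` [set y]).
    by have := ms n measurableT [set y] (measurable_set1 y); rewrite setTI.
  have I1 y : integrableR Pr (fun x => f x * \1_(s n @^-1` [set y]) x).
    apply: (integrableR_bounded _ _ 1 If) => [|x]; first exact: indm.
    by rewrite indicE; case: (_ \in _); rewrite ?normr1 ?normr0.
  rewrite Rexp_sum => [|i]; last exact: integrableRZ.
  by apply: big1 => i _; rewrite RexpZ// f0// mulr0.
Qed.
End moments.

(** * Orthogonality from conditional mean zero and from independence *)

Section meas_wrt_lemmas.
Context {d} {T : measurableType d} {R : realType}.
Implicit Types (G : set (set T)) (h : T -> R) (A : set T).

Lemma meas_wrt_mono G G' h : G `<=` G' -> meas_wrt G h -> meas_wrt G' h.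
Proof.
move=> GG' mh _ B mB; have := mh measurableT B mB.
apply: smallest_sub; first exact: smallest_sigma_algebra.
by apply: subset_trans GG' _; exact: sub_sigma_algebra.
Qed.

Lemma meas_wrt_rv G h : rv_sets h `<=` G -> meas_wrt G h.
Proof.
move=> hG _ B mB; rewrite setTI; apply: sub_sigma_algebra; apply: hG.
by exists B.
Qed.

Lemma meas_wrt_indic G A : <<s G >> A -> meas_wrt G (\1_A : T -> R).
Proof. by move=> GA; exact: (@measurable_indic _ (g_sigma_algebraType G)). Qed.

Lemma meas_wrt_cst G (k : R) : meas_wrt G (fun=> k).
Proof. exact: measurable_cst. Qed.

Lemma meas_wrtM G (f h : T -> R) : meas_wrt G f -> meas_wrt G h ->
  meas_wrt G (fun x => f x * h x).
Proof. exact: measurable_funM. Qed.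

Lemma meas_wrtB G (f h : T -> R) : meas_wrt G f -> meas_wrt G h ->
  meas_wrt G (fun x => f x - h x).
Proof. exact: measurable_funB. Qed.

Lemma sigma_sub_measurable G A : (forall A, G A -> measurable A) ->
  <<s G >> A -> measurable A.
Proof.
by move=> GM; apply: smallest_sub => //; exact: sigma_algebra_measurable.
Qed.

Lemma indic_norm_le1 A x : `|\1_A x : R| <= 1.
Proof. by rewrite indicE; case: (_ \in _); rewrite ?normr1 ?normr0. Qed.

Lemma cond_exp_zero_orth (Pr : probability T R) G (f h : T -> R) :
  (forall A, G A -> measurable A) -> cond_exp_zero Pr f <<s G >> ->
  meas_wrt G h -> integrableR Pr (fun x => f x * h x) ->
  \int[Pr]_x (f x * h x) = 0.
Proof.
move=> GM [If f0]; apply: pull_out => // A GA.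
have mA := sigma_sub_measurable _ _ GM GA.
transitivity (fine (\int[Pr]_(x in A) (f x)%:E)%E); last by rewrite f0.
rewrite integral_mkcond /Rintegral; congr fine; apply: eq_integral => x _.
by rewrite patchE indicE; case: (x \in A); rewrite ?mulr1 ?mulr0.
Qed.

(** The test weight of the moment relations: bounded, so products of square-integrable variables
    stay integrable against it, and of mean zero, so it annihilates constants. *)
Definition centered_indic (Pr : probability T R) A x : R := \1_A x - fine (Pr A).

Lemma centered_indic_bounded (Pr : probability T R) A x :
  `|centered_indic Pr A x| <= 1 + `|fine (Pr A)|.
Proof.
rewrite (le_trans (ler_normB _ _))// lerD2r.
exact: indic_norm_le1.
Qed.

Lemma meas_wrt_centered_indic G (Pr : probability T R) A :
  <<s G >> A -> meas_wrt G (centered_indic Pr A).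
Proof.
by move=> GA; apply: meas_wrtB; [exact: meas_wrt_indic|exact: meas_wrt_cst].
Qed.

Lemma measurable_centered_indic (Pr : probability T R) A : measurable A ->
  measurable_fun setT (centered_indic Pr A).
Proof.
by move=> mA; apply: measurable_funB => //; exact: measurable_indic.
Qed.

Lemma Rexp_indic (Pr : probability T R) A : measurable A ->
  \int[Pr]_x \1_A x = fine (Pr A).
Proof. by move=> mA; rewrite /Rintegral integral_indic// setIT. Qed.

(** Independence says that the centred indicator of [A] integrates to zero over every event of
    [<<s G >>]; [pull_out] applies with it in the role of [f]. *)
Lemma indep_orth (Pr : probability T R) (F : set (set T)) G A h :
  (forall A, F A -> measurable A) -> (forall A, G A -> measurable A) ->
  indep_sigma Pr <<s F >> <<s G >> -> <<s F >> A ->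
  meas_wrt G h -> integrableR Pr h ->
  \int[Pr]_x (centered_indic Pr A x * h x) = 0.
Proof.
move=> FM GM FG FA mh Ih.
have mA := sigma_sub_measurable _ _ FM FA.
have I1 B : measurable B -> integrableR Pr (\1_B : T -> R).
  by move=> mB; apply: integrable_indic => //; rewrite -ge0_fin_numE// fin_num_measure.
have Ic : integrableR Pr (centered_indic Pr A).
  by apply: integrableRB; [exact: I1|exact: integrableR_cst].
apply: (pull_out _ G) => //.
- move=> B GB; have mB := sigma_sub_measurable _ _ GM GB.
  transitivity (\int[Pr]_x (\1_(A `&` B) x - fine (Pr A) * \1_B x)).
    by apply: eq_Rintegral => x _; rewrite /centered_indic mulrBl indicI.
  rewrite RexpB; last 2 first.
  + by apply: I1; exact: measurableI.
  + by apply: integrableRZ; exact: I1.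
  rewrite RexpZ ?Rexp_indic//; last by apply: I1.
  + by rewrite FG// fineM ?fin_num_measure// subrr.
  + exact: measurableI.
- under [X in integrableR _ X]eq_fun do rewrite mulrC.
  apply: (integrableR_bounded _ _ _ _ Ih).
    exact: measurable_centered_indic.
  exact: centered_indic_bounded.
Qed.

End meas_wrt_lemmas.

(** * The structural equations *)

Section swap_and_disturbances.
Context {R : realType} {p : nat}.
Implicit Type M : SEM R p.

(** Exchange of X and Y. [RX M] is [RY (swap M)] by conversion, so results on [RY] and Assumption A
    carry over to [RX] and Assumption A'. *)
Definition swap M : SEM R p :=
  MkSEM (P M) (Y M) (X M) (Z M) (U M) (Defs.eta M) (zeta M) (bYX M) (bXY M)
    (piY M) (piX M) (xiX M) (xiY M).

Lemma l2norm_xrow (v : 'cV[R]_2) : l2norm (xrow 0 1 v) = l2norm v.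
Proof.
rewrite /l2norm !big_ord_recl !big_ord0 !mxE !addr0 addrC.
rewrite !perm.permE /=. 
by congr (Num.sqrt (_ + v _ _ ^+ 2)); exact/val_inj.
Qed.

Lemma Bmat_swap M (v : 'cV[R]_2) :
  Bmat (swap M) *m v = xrow 0 1 (Bmat M *m xrow 0 1 v).
Proof.
apply/matrixP => i j; rewrite !mxE !big_ord_recl !big_ord0 !mxE !perm.permE !addr0.
case: i => [[|[|//]] Hi] /=; rewrite !mul0r ?addr0 ?add0r; congr (_ * v _ _);
  exact/val_inj.
Qed.

(** The two matrices are conjugate under the exchange of coordinates, an isometric involution, so
    both suprema range over the same set. *)
Lemma spec_norm_swap M : spec_norm (Bmat (swap M)) = spec_norm (Bmat M).
Proof.
have xrowK : involutive (@xrow R 2 1 0 1).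
  move=> v; rewrite /xrow -row_permM; rewrite (_ : (_ * _)%g = 1%g) ?row_perm1//.
  exact: perm.tperm2.
rewrite /spec_norm; congr sup; apply/seteqP; split => _ [v /= v1 <-].
  by exists (xrow 0 1 v) => /=; rewrite ?l2norm_xrow// Bmat_swap l2norm_xrow.
exists (xrow 0 1 v) => /=; rewrite ?l2norm_xrow//.
by rewrite Bmat_swap xrowK l2norm_xrow.
Qed.

Lemma swap_valid M : valid_model M -> valid_model (swap M).
Proof.
move=> [[[mX mY mZ mU [mz me mxY mxX]] [X2 Y2 X0 Y0] [Z2 Z0 S]]].
move=> [[EY EX] [iY Y1 iX X1 ind] [cz ce] B1].
have B2 : spec_norm (Bmat (swap M)) < 1 by rewrite spec_norm_swap.
by split; split.
Qed.

Definition genZ M : set (set (T M)) := \bigcup_(j in setT) rv_sets (Z M j).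
Definition genU M : set (set (T M)) :=
  [set U M @^-1` B | B in [set B : set (UT M) | measurable B]].

Definition eX M w := X M w - \sum_j gammaX M j * Z M j w.
Definition eY M w := Y M w - \sum_j gammaY M j * Z M j w.

Section disturbances.
Variable M : SEM R p.
Hypothesis V : valid_model M.

Lemma rv_sets_measurable (f : T M -> R) : measurable_fun setT f ->
  forall A, rv_sets f A -> measurable A.
Proof. by move=> mf _ [B mB <-]; have := mf measurableT B mB; rewrite setTI. Qed.

Lemma genZ_measurable A : genZ M A -> measurable A.
Proof.
case: V => [[[_ _ mZ _ _] _ _] _] [j _].
exact: rv_sets_measurable.
Qed.

Lemma genU_measurable A : genU M A -> measurable A.
Proof.
case: V => [[[_ _ _ mU _] _ _] _] [B mB <-].
by have := mU measurableT B mB; rewrite setTI.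
Qed.

Lemma gen_etaZU_measurable A :
  (rv_sets (Defs.eta M) `|` genZ M `|` genU M) A -> measurable A.
Proof.
case: V => [[[_ _ mZ mU [_ me _ _]] _ _] _] [[]|].
- exact: rv_sets_measurable.
- exact: genZ_measurable.
- exact: genU_measurable.
Qed.

Lemma L2_X : L2 (P M) (X M). Proof. by case: V => [[[? ? _ _ _] []]]. Qed.
Lemma L2_Y : L2 (P M) (Y M). Proof. by case: V => [[[? ? _ _ _] []]]. Qed.
Lemma L2_Z j : L2 (P M) (Z M j).
Proof. by case: V => [[[? ? ? _ _] _ []]]. Qed.

Lemma RYE w : RY M w = Y M w - bXY M * X M w - \sum_j piY M j * Z M j w.
Proof. case: V => [_ [[EY _] _ _ _]]; rewrite {1}EY /RY; ring. Qed.

(** The summands [xiY(U)] and [zeta] are only assumed integrable; square integrability is read off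
    X, Y and Z through [RYE]. *)
Lemma L2_RY : L2 (P M) (RY M).
Proof.
rewrite (funext RYE); apply: L2B; last by apply: L2_sum => j; exact/L2Z/L2_Z.
by apply: L2B; [exact: L2_Y|exact/L2Z/L2_X].
Qed.

Lemma meas_xiY : meas_wrt (genU M) (xiY M \o U M).
Proof.
case: V => [[[_ _ _ mU [_ _ mx _]] _ _] _].
apply: meas_wrt_rv => _ [B mB <-]; exists (xiY M @^-1` B) => //.
by have := mx measurableT B mB; rewrite setTI.
Qed.

Lemma meas_Z j : meas_wrt (genZ M) (Z M j).
Proof. by apply: meas_wrt_rv => A HA; exists j. Qed.

Lemma Rexp_of_E (f : T M -> R) : ('E_(P M)[f] = 0)%E -> \int[P M]_x f x = 0.
Proof. by rewrite unlock /Rintegral => ->. Qed.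

(** This is E(R_Y | Z) = 0: [zeta] has conditional mean zero given a larger sigma-algebra, and
    [xiY(U)] is independent of Z with mean zero. *)
Lemma RY_sigmaZ A : <<s genZ M >> A -> \int[P M]_x (RY M x * \1_A x) = 0.
Proof.
move=> ZA.
have mA := sigma_sub_measurable _ _ genZ_measurable ZA.
case: V => [_ [_ [iY Y1 _ _ ind] [cz _] _]].
have b1 (f : T M -> R) : integrableR (P M) f ->
    integrableR (P M) (fun x => f x * \1_A x).
  move=> If; apply: integrableR_bounded If _ (indic_norm_le1 A).
  exact: measurable_indic.
transitivity (\int[P M]_x ((xiY M \o U M) x * \1_A x + zeta M x * \1_A x)).
  by apply: eq_Rintegral => x _; rewrite -mulrDl.
rewrite RexpD; [|exact: b1|by apply: b1; case: cz].
rewrite (cond_exp_zero_orth _ _ _ _ gen_etaZU_measurable cz); last 2 first.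
- apply: meas_wrt_indic.
  by apply: smallest_sub ZA; [exact: smallest_sigma_algebra|
    move=> B HB; apply: sub_sigma_algebra; left; right].
- by apply: b1; case: cz.
rewrite addr0.
have := indep_orth _ _ _ _ _ genZ_measurable genU_measurable ind ZA meas_xiY iY.
rewrite (_ : \int[P M]_x _ = \int[P M]_x ((xiY M \o U M) x * \1_A x
   - fine (P M A) * (xiY M \o U M) x)); last first.
  by apply: eq_Rintegral => x _; rewrite /centered_indic; ring.
rewrite RexpB; [|exact: b1|exact: integrableRZ].
by rewrite RexpZ// (Rexp_of_E _ Y1) mulr0 subr0.
Qed.

Lemma RY_orth h : meas_wrt (genZ M) h ->
  integrableR (P M) (fun x => RY M x * h x) -> \int[P M]_x (RY M x * h x) = 0.
Proof.
apply: pull_out; first exact: genZ_measurable.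
  exact/L2_integrable/L2_RY.
exact: RY_sigmaZ.
Qed.

End disturbances.
End swap_and_disturbances.

(** * Constancy of E(R_X R_Y | Z) *)

Section uncorrelated_disturbances.
Context {R : realType} {p : nat}.
Implicit Type M : SEM R p.

(* [xiX(U)] and [xiY(U)] are only assumed integrable, so their product need not
   be: the four terms of [RX * RY] are separated after truncating both on [B n],
   and the truncation is removed by dominated convergence of [RX * RY] itself. *)
Lemma RX_RY_orth M (A : set (T M)) : valid_model M -> <<s genZ M >> A ->
  \int[P M]_x (RX M x * RY M x * centered_indic (P M) A x) = 0.
Proof.
move=> V ZA; have V' := swap_valid _ V.
have GZ := genZ_measurable _ V; have GU := genU_measurable _ V.
have mA := sigma_sub_measurable _ _ GZ ZA.
case: (V) => [[[_ _ _ _ [mz me _ _]] _ _] [_ [_ _ _ _ ind] [cz ce] _]].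
have Iz : integrableR (P M) (zeta M) by case: cz.
have Ie : integrableR (P M) (Defs.eta M) by case: ce.
pose xY := xiY M \o U M; pose xX := xiX M \o U M.
have myU : meas_wrt (genU M) xY by exact: meas_xiY.
have mxU : meas_wrt (genU M) xX by exact: (meas_xiY _ V').
pose w := centered_indic (P M) A.
have mw : measurable_fun setT w by exact: measurable_centered_indic.
have wK x : `|w x| <= 1 + `|fine (P M A)| by exact: centered_indic_bounded.
have I0 : integrableR (P M) (fun x => RX M x * RY M x * w x).
  apply: integrableR_bounded mw wK; apply: L2M; last exact: L2_RY.
  exact: (L2_RY _ V').
(* [B n] is an event of sigma(U), so its indicator can join a test function without leaving the
   conditioning sigma-algebras. *)
pose B n := xY @^-1` `[- n%:R, n%:R] `&` xX @^-1` `[- n%:R, n%:R].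
have UB n : <<s genU M >> (B n).
  have mB (f : T M -> R) : meas_wrt (genU M) f ->
      <<s genU M >> (f @^-1` `[- n%:R, n%:R]).
    by move=> mf; rewrite -[X in <<s _ >> X]setTI; apply: mf => //;
      exact: measurable_itv.
  exact: (@measurableI _ (g_sigma_algebraType (genU M)) _ _ (mB _ myU) (mB _ mxU)).
pose t n : T M -> R := \1_(B n).
have mtU n : meas_wrt (genU M) (t n) by exact: meas_wrt_indic.
have t1 n x : `|t n x| <= 1 by exact: indic_norm_le1.
have tE n x : t n x = 1 /\ `|xY x| <= n%:R /\ `|xX x| <= n%:R \/ t n x = 0.
  rewrite /t indicE; case: (boolP (x \in B n)) => [/set_mem[]|_]; last by right.
  by rewrite /= !in_itv /= -!ler_norml; left.
have tX n x : `|xX x * t n x| <= n%:R.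
  by case: (tE n x) => [[-> [_]]|->]; rewrite ?mulr1 ?mulr0 ?normr0.
have tY n x : `|xY x * t n x| <= n%:R.
  by case: (tE n x) => [[-> []]|->]; rewrite ?mulr1 ?mulr0 ?normr0.
have tXY n x : `|xX x * xY x * t n x| <= n%:R * n%:R.
  case: (tE n x) => [[-> []]|->]; rewrite ?mulr1 ?mulr0 ?normr0 ?mulr_ge0//.
  by move=> *; rewrite normrM ler_pM.
apply: (@dominated_Rexp _ _ _ _ (fun n x => RX M x * RY M x * w x * t n x) _
  (fun x => `|RX M x * RY M x * w x|)).
- move=> n; apply: measurable_funM; first exact: integrableR_measurable I0.
  exact: meas_wrtS (mtU n).
- exact: integrableR_measurable I0.
- move=> x; rewrite -[X in _ --> X]mulr1; apply: cvgMl_tmp.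
  apply: cvg_near_cst; near=> n.
  rewrite /t indicE mem_set// /B /= !in_itv /= -!ler_norml.
  split; near: n; exact: nbhs_infty_ger.
- exact: integrable_norm I0.
- by move=> n x; rewrite normrM ler_piMr.
move=> n.
have mt : measurable_fun setT (t n) by exact: meas_wrtS (mtU n).
have mX : measurable_fun setT xX by exact: meas_wrtS mxU.
have mY : measurable_fun setT xY by exact: meas_wrtS myU.
have sub1 : genU M `<=` rv_sets (Defs.eta M) `|` genZ M `|` genU M.
  by move=> C HC; right.
have sub2 : genZ M `<=` rv_sets (Defs.eta M) `|` genZ M `|` genU M.
  by move=> C HC; left; right.
have sub3 : genU M `<=` rv_sets (zeta M) `|` genZ M `|` genU M.
  by move=> C HC; right.
have sub4 : genZ M `<=` rv_sets (zeta M) `|` genZ M `|` genU M.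
  by move=> C HC; left; right.
have mwZ : meas_wrt (genZ M) w by exact: meas_wrt_centered_indic.
(* The truncated product is [w h1 + zeta h2 + eta h3 + zeta h4]. *)
pose h1 x := xX x * xY x * t n x.
pose h2 x := xX x * t n x * w x.
pose h3 x := xY x * t n x * w x.
pose h4 x := Defs.eta M x * t n x * w x.
have wK0 : 0 <= 1 + `|fine (P M A)| by rewrite addr_ge0.
have Ih1 : integrableR (P M) h1.
  apply: (integrableR_le _ _ (fun=> n%:R * n%:R)).
  - by apply: measurable_funM => //; exact: measurable_funM.
  - exact: integrableR_cst.
  - by move=> x; rewrite [leRHS]ger0_norm ?mulr_ge0//; exact: tXY.
have I1 : integrableR (P M) (fun x => w x * h1 x).
  exact: integrableR_bounded_l Ih1 mw wK.
have I2 : integrableR (P M) (fun x => zeta M x * h2 x).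
  apply: (integrableR_bounded _ _ _ (n%:R * (1 + `|fine (P M A)|))) => //.
  - by apply: measurable_funM => //; exact: measurable_funM.
  - by move=> x; rewrite normrM ler_pM.
have I3 : integrableR (P M) (fun x => Defs.eta M x * h3 x).
  apply: (integrableR_bounded _ _ _ (n%:R * (1 + `|fine (P M A)|))) => //.
  - by apply: measurable_funM => //; exact: measurable_funM.
  - by move=> x; rewrite normrM ler_pM.
have It : integrableR (P M) (fun x => RX M x * RY M x * w x * t n x).
  exact: (integrableR_bounded _ _ _ 1).
(* No integrability is assumed for [zeta * eta]; its truncated version inherits it from the four
   integrable terms on the right. *)
have E4 x : zeta M x * h4 x = RX M x * RY M x * w x * t n x
    - w x * h1 x - zeta M x * h2 x - Defs.eta M x * h3 x.
  by rewrite /h1 /h2 /h3 /h4 /RX /RY /xX /xY /=; ring.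
have I4 : integrableR (P M) (fun x => zeta M x * h4 x).
  rewrite (funext E4); apply: integrableRB => //.
  by apply: integrableRB => //; exact: integrableRB.
(* Here the centring of [w] matters: the truncated E(xiX(U) xiY(U)) may be nonzero, but it is
   constant given Z. The other terms vanish through [zeta] or [eta]. *)
have O1 : \int[P M]_x (w x * h1 x) = 0.
  apply: (indep_orth _ _ _ _ _ GZ GU ind ZA _ Ih1).
  by apply: meas_wrtM => //; exact: meas_wrtM.
have O2 : \int[P M]_x (zeta M x * h2 x) = 0.
  apply: cond_exp_zero_orth (gen_etaZU_measurable _ V) cz _ I2.
  by apply: meas_wrtM; [apply: (meas_wrt_mono _ _ _ sub1); exact: meas_wrtM|
    exact: (meas_wrt_mono _ _ _ sub2)].
have O3 : \int[P M]_x (Defs.eta M x * h3 x) = 0.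
  apply: cond_exp_zero_orth (gen_etaZU_measurable _ V') ce _ I3.
  by apply: meas_wrtM; [apply: (meas_wrt_mono _ _ _ sub3); exact: meas_wrtM|
    exact: (meas_wrt_mono _ _ _ sub4)].
have O4 : \int[P M]_x (zeta M x * h4 x) = 0.
  apply: cond_exp_zero_orth (gen_etaZU_measurable _ V) cz _ I4.
  apply: meas_wrtM; last exact: (meas_wrt_mono _ _ _ sub2).
  apply: meas_wrtM; last exact: (meas_wrt_mono _ _ _ sub1).
  by apply: meas_wrt_rv => C HC; left; left.
have := O4; under eq_Rintegral do rewrite E4.
rewrite !RexpB//; last 2 first.
- exact: integrableRB.
- by apply: integrableRB => //; exact: integrableRB.
by rewrite O1 O2 O3 !subr0.
Unshelve. all: by end_near.
Qed.

End uncorrelated_disturbances.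

(** * Quantities determined by the observed law *)

Section observed_law.
Context {R : realType} {p : nat}.
Implicit Type M : SEM R p.
Notation obsT := (R * R * ('I_p -> R))%type.

Definition obs_gen : set (set obsT) :=
  rv_sets (fun o : obsT => o.1.1) `|` rv_sets (fun o : obsT => o.1.2)
  `|` \bigcup_(j in [set: 'I_p]) rv_sets (fun o : obsT => o.2 j).

(** Conditions on Z expressed on the common observation space, where models with different
    probability spaces can be compared. *)
Definition obs_genZ : set (set obsT) :=
  \bigcup_(j in [set: 'I_p]) rv_sets (fun o : obsT => o.2 j).

Lemma sigmaZ_obs M (S : set obsT) :
  <<s obs_genZ >> S -> <<s genZ M >> (obs M @^-1` S).
Proof.
move=> ZS; pose C := [set S0 : set obsT | <<s genZ M >> (obs M @^-1` S0)].
suff : <<s obs_genZ >> `<=` C by apply.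
apply: smallest_sub; last first.
  move=> _ [j _ [B mB <-]]; apply: sub_sigma_algebra; exists j => //.
  by exists B.
have [h0 hC hU] := smallest_sigma_algebra setT (genZ M).
split; first by rewrite /C /= preimage_set0.
- by move=> S0; rewrite /C /= !setTD => /hC; rewrite setTD.
- by move=> F HF; rewrite /C /= preimage_bigcup; exact: hU.
Qed.

(** Preimages of a sigma-algebra form a sigma-algebra. This allows an event found in one model to be
    carried to another. *)
Lemma obs_sigmaZ M (A : set (T M)) : <<s genZ M >> A ->
  exists2 S : set obsT, <<s obs_genZ >> S & A = obs M @^-1` S.
Proof.
move=> ZA.
suff /(_ A ZA) [S ZS] : <<s genZ M >> `<=`
    preimage_set_system setT (obs M) <<s obs_genZ >>.
  by rewrite setTI => <-; exists S.
apply: smallest_sub; first exact/sigma_algebra_preimage/smallest_sigma_algebra.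
move=> _ [j _ [B mB <-]]; exists ((fun o : obsT => o.2 j) @^-1` B).
  by apply: sub_sigma_algebra; exists j => //; exists B.
by rewrite setTI.
Qed.

Lemma measurable_obs M : valid_model M ->
  measurable_fun setT (obs M : T M -> g_sigma_algebraType obs_gen).
Proof.
move=> V; case: (V) => [[[mX mY mZ _ _] _ _] _].
apply: (@measurability _ _ _ (g_sigma_algebraType obs_gen) _ _ obs_gen) => //.
move=> _ [S HS <-]; rewrite setTI.
case: HS => [[[B mB <-]|[B mB <-]]|[j _ [B mB <-]]].
- by have := mX measurableT B mB; rewrite setTI.
- by have := mY measurableT B mB; rewrite setTI.
- by have := mZ j measurableT B mB; rewrite setTI.
Qed.

(** Both sides are integrals of [F] against the image measures under [obs], which agree on
    [obs_sigma]. *)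
Lemma same_law_Rexp M1 M2 (F : obsT -> R) :
  valid_model M1 -> valid_model M2 -> same_obs_law M1 M2 ->
  measurable_fun setT (F : g_sigma_algebraType obs_gen -> R) ->
  integrableR (P M1) (F \o obs M1) -> integrableR (P M2) (F \o obs M2) ->
  \int[P M1]_x F (obs M1 x) = \int[P M2]_x F (obs M2 x).
Proof.
move=> V1 V2 law mF I1 I2; rewrite /Rintegral; congr fine.
have mEF : measurable_fun setT
  (EFin \o F : g_sigma_algebraType obs_gen -> \bar R) by exact/measurable_EFinP.
have m1 := measurable_obs _ V1; have m2 := measurable_obs _ V2.
have := integral_pushforward m1 mEF I1 measurableT.
have := integral_pushforward m2 mEF I2 measurableT.
rewrite !preimage_setT /= => <- <-.
by apply: eq_measure_integral => S mS _; exact: law.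
Qed.

End observed_law.

(** * Regression on Z and moments of the residuals *)

Section residuals.
Context {R : realType} {p : nat}.
Implicit Type M : SEM R p.
Notation obsT := (R * R * ('I_p -> R))%type.

Lemma gammaXE M : bXY M * bYX M = 0 ->
  forall j, gammaX M j = piX M j + bYX M * piY M j.
Proof. by move=> bc j; rewrite /gammaX bc subr0 divr1. Qed.

Lemma gammaYE M : bXY M * bYX M = 0 ->
  forall j, gammaY M j = piY M j + bXY M * piX M j.
Proof. by move=> bc j; rewrite /gammaY bc subr0 divr1. Qed.

(** The Z-terms match because gamma_Y - b gamma_X = pi_Y. *)
Lemma RY_eY M w : valid_model M -> bXY M * bYX M = 0 ->
  RY M w = eY M w - bXY M * eX M w.
Proof.
move=> V bc; rewrite (RYE _ V) /eX /eY.
have -> : \sum_j gammaY M j * Z M j w =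
    \sum_j piY M j * Z M j w + bXY M * \sum_j piX M j * Z M j w.
  rewrite mulr_sumr -big_split; apply: eq_bigr => j _ /=.
  by rewrite gammaYE//; ring.
have -> : bXY M * (X M w - \sum_j gammaX M j * Z M j w) =
    bXY M * X M w - bXY M * \sum_j piX M j * Z M j w.
  rewrite mulrBr !mulr_sumr; congr (_ - _); apply: eq_bigr => j _ /=.
  rewrite gammaXE// mulrDl mulrDr.
  by rewrite -[bYX M * _ * _]mulrA [bXY M * (bYX M * _)]mulrA bc mul0r addr0.
ring.
Qed.

Lemma gammaX_swap M : gammaX (swap M) = gammaY M.
Proof.
by apply/funext => j; rewrite /gammaX /gammaY /= [bYX M * bXY M]mulrC.
Qed.

Lemma gammaY_swap M : gammaY (swap M) = gammaX M.
Proof.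
by apply/funext => j; rewrite /gammaX /gammaY /= [bYX M * bXY M]mulrC.
Qed.

Lemma eX_swap M : eX (swap M) = eY M.
Proof.
by apply/funext => w; rewrite /eX /eY ?gammaX_swap ?gammaY_swap.
Qed.

Lemma eY_swap M : eY (swap M) = eX M.
Proof.
by apply/funext => w; rewrite /eX /eY ?gammaX_swap ?gammaY_swap.
Qed.

Lemma RX_eX M w : valid_model M -> bXY M * bYX M = 0 ->
  RX M w = eX M w - bYX M * eY M w.
Proof.
move=> V bc; have := RY_eY (swap M) w (swap_valid _ V).
by rewrite eX_swap eY_swap; apply; rewrite /= mulrC.
Qed.

Lemma eY_R M w : valid_model M -> bXY M * bYX M = 0 ->
  eY M w = RY M w + bXY M * RX M w.
Proof.
move=> V bc; rewrite RY_eY// RX_eX//.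
have H : bXY M * (bYX M * eY M w) = 0 by rewrite mulrA bc mul0r.
rewrite -[LHS]subr0 -H; ring.
Qed.

Lemma RX_orth M h : valid_model M -> meas_wrt (genZ M) h ->
  integrableR (P M) (fun x => RX M x * h x) -> \int[P M]_x (RX M x * h x) = 0.
Proof. by move=> V; exact: (RY_orth _ (swap_valid _ V)). Qed.

Lemma L2_RX M : valid_model M -> L2 (P M) (RX M).
Proof. by move=> V; exact: (L2_RY _ (swap_valid _ V)). Qed.

Lemma L2_eX M : valid_model M -> L2 (P M) (eX M).
Proof.
move=> V; apply: L2B; first exact: L2_X.
by apply: L2_sum => j; apply: L2Z; exact: L2_Z.
Qed.

Lemma L2_eY M : valid_model M -> L2 (P M) (eY M).
Proof. by move=> V; rewrite -eX_swap; exact: (L2_eX (swap M) (swap_valid _ V)). Qed.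

Lemma SigmaE M : Sigma M = \matrix_(j, k) \int[P M]_x (Z M j x * Z M k x).
Proof. by apply/matrixP => j k; rewrite !mxE unlock. Qed.

(** Normal equations of the regression: e_Y = R_Y + b R_X is orthogonal to every Z_j. *)
Lemma Rexp_YZ M j : valid_model M -> bXY M * bYX M = 0 ->
  \int[P M]_x (Y M x * Z M j x) = \sum_k gammaY M k * Sigma M k j.
Proof.
move=> V bc; have LZ k := L2_Z _ V k.
have IRY := L2M _ _ _ (L2_RY _ V) (LZ j).
have IRX := L2M _ _ _ (L2_RX _ V) (LZ j).
transitivity (\int[P M]_x ((RY M x * Z M j x + bXY M * (RX M x * Z M j x)) +
    \sum_k gammaY M k * (Z M k x * Z M j x))).
  apply: eq_Rintegral => x _.
  transitivity ((eY M x + \sum_k gammaY M k * Z M k x) * Z M j x).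
    by rewrite /eY subrK.
  rewrite eY_R// mulrDl mulrDl -[bXY M * _ * _]mulrA mulr_suml.
  congr (_ + _).
  by apply: eq_bigr => k _; rewrite -mulrA.
have Is k : integrableR (P M) (fun x => gammaY M k * (Z M k x * Z M j x)).
  exact/integrableRZ/L2M.
rewrite RexpD; last 2 first.
- by apply: integrableRD => //; exact: integrableRZ.
- exact: integrableR_sum.
rewrite RexpD//; last exact: integrableRZ.
rewrite RexpZ// RY_orth// ?RX_orth//; [|exact: meas_Z..].
rewrite mulr0 !add0r Rexp_sum//; apply: eq_bigr => k _.
by rewrite RexpZ ?SigmaE ?mxE//; exact: L2M.
Qed.

Lemma measurable_obsX : measurable_fun setT
  ((fun o : obsT => o.1.1) : g_sigma_algebraType (@obs_gen R p) -> R).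
Proof.
move=> _ B mB; rewrite setTI; apply: sub_sigma_algebra; left; left.
by exists B.
Qed.

Lemma measurable_obsY : measurable_fun setT
  ((fun o : obsT => o.1.2) : g_sigma_algebraType (@obs_gen R p) -> R).
Proof.
move=> _ B mB; rewrite setTI; apply: sub_sigma_algebra; left; right.
by exists B.
Qed.

Lemma measurable_obsZ j : measurable_fun setT
  ((fun o : obsT => o.2 j) : g_sigma_algebraType (@obs_gen R p) -> R).
Proof.
move=> _ B mB; rewrite setTI; apply: sub_sigma_algebra; right.
by exists j => //; exists B.
Qed.

(** E(ZZ^T) and E(YZ) are determined by the law, and the normal equations have one solution since
    [Sigma] is invertible. *)
Lemma gammaY_law M1 M2 : valid_model M1 -> valid_model M2 ->
  bXY M1 * bYX M1 = 0 -> bXY M2 * bYX M2 = 0 -> same_obs_law M1 M2 ->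
  gammaY M1 = gammaY M2.
Proof.
move=> V1 V2 bc1 bc2 law.
have ES : Sigma M1 = Sigma M2.
  rewrite !SigmaE; apply/matrixP => j k; rewrite !mxE.
  apply: (same_law_Rexp _ _ (fun o => o.2 j * o.2 k)) => //.
  - by apply: measurable_funM; exact: measurable_obsZ.
  - by apply: L2M; exact: L2_Z.
  - by apply: L2M; exact: L2_Z.
have EYZ j : \int[P M1]_x (Y M1 x * Z M1 j x) = \int[P M2]_x (Y M2 x * Z M2 j x).
  apply: (same_law_Rexp _ _ (fun o => o.1.2 * o.2 j)) => //.
  - by apply: measurable_funM; [exact: measurable_obsY|exact: measurable_obsZ].
  - by apply: L2M; [exact: L2_Y|exact: L2_Z].
  - by apply: L2M; [exact: L2_Y|exact: L2_Z].
have SU : Sigma M1 \in unitmx by case: V1 => [[_ _ []]].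
suff : \row_j gammaY M1 j = \row_j gammaY M2 j.
  by move=> /rowP H; apply/funext => j; have := H j; rewrite !mxE.
apply: (can_inj (mulmxK SU)); apply/rowP => j; rewrite !mxE.
transitivity (\sum_k gammaY M1 k * Sigma M1 k j).
  by apply: eq_bigr => k _; rewrite mxE.
rewrite -Rexp_YZ// EYZ Rexp_YZ// -ES.
by apply: eq_bigr => k _; congr (_ * _); rewrite mxE.
Qed.

Lemma same_law_swap M1 M2 : same_obs_law M1 M2 -> same_obs_law (swap M1) (swap M2).
Proof.
move=> law S HS.
pose f (o : obsT) : obsT := (o.1.2, o.1.1, o.2).
suff Sf : @obs_sigma R p (f @^-1` S) by exact: law Sf.
have : measurable_fun setT
  (f : g_sigma_algebraType (@obs_gen R p) -> g_sigma_algebraType (@obs_gen R p)).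
  apply: (@measurability _ _ (g_sigma_algebraType obs_gen)
    (g_sigma_algebraType obs_gen) _ _ obs_gen) => //.
  move=> _ [A HA <-]; rewrite setTI; apply: sub_sigma_algebra.
  case: HA => [[[B mB <-]|[B mB <-]]|[j _ [B mB <-]]].
  - by left; right; exists B.
  - by left; left; exists B.
  - by right; exists j => //; exists B.
by move=> mf; have := mf measurableT S HS; rewrite setTI.
Qed.

Lemma gammaX_law M1 M2 : valid_model M1 -> valid_model M2 ->
  bXY M1 * bYX M1 = 0 -> bXY M2 * bYX M2 = 0 -> same_obs_law M1 M2 ->
  gammaX M1 = gammaX M2.
Proof.
move=> V1 V2 bc1 bc2 law.
have := gammaY_law (swap M1) (swap M2) (swap_valid _ V1) (swap_valid _ V2).
rewrite /= [bYX M1 * _]mulrC [bYX M2 * _]mulrC => /(_ bc1 bc2 (same_law_swap _ _ law)).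
by rewrite !gammaY_swap.
Qed.

(** The covariance of [f * g] with the indicator of [A], when [f * g] is integrable. *)
Definition centered_moment M (f g : T M -> R) (A : set (T M)) : R :=
  \int[P M]_x (f x * g x * centered_indic (P M) A x).

Lemma centered_moment_integrable M (f g : T M -> R) A : valid_model M ->
  L2 (P M) f -> L2 (P M) g -> <<s genZ M >> A ->
  integrableR (P M) (fun x => f x * g x * centered_indic (P M) A x).
Proof.
move=> V Lf Lg ZA; apply: (integrableR_bounded _ _ _ _ _ _ (centered_indic_bounded _ _)).
  exact: L2M.
apply: measurable_centered_indic; apply: sigma_sub_measurable ZA.
exact: genZ_measurable.
Qed.

(** Expand R_X R_Y = (e_X - c e_Y)(e_Y - b e_X) in [RX_RY_orth]; the term b c e_X e_Y vanishes. *)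
Lemma centered_moment_relation M A : valid_model M -> bXY M * bYX M = 0 ->
  <<s genZ M >> A ->
  centered_moment M (eX M) (eY M) A =
  bYX M * centered_moment M (eY M) (eY M) A +
  bXY M * centered_moment M (eX M) (eX M) A.
Proof.
move=> V bc ZA.
have LX := L2_eX _ V; have LY := L2_eY _ V.
have IXY := centered_moment_integrable _ _ _ _ V LX LY ZA.
have IXX := centered_moment_integrable _ _ _ _ V LX LX ZA.
have IYY := centered_moment_integrable _ _ _ _ V LY LY ZA.
have := RX_RY_orth _ _ V ZA.
rewrite (_ : \int[P M]_x _ = \int[P M]_x (
    (eX M x * eY M x * centered_indic (P M) A x
     - bYX M * (eY M x * eY M x * centered_indic (P M) A x))
     - bXY M * (eX M x * eX M x * centered_indic (P M) A x))); last first.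
  apply: eq_Rintegral => x _; rewrite RX_eX// RY_eY//.
  have H0 : bXY M * bYX M * (eX M x * eY M x * centered_indic (P M) A x) = 0.
    by rewrite bc mul0r.
  rewrite -[RHS]addr0 -H0; ring.
have ZIX := integrableRZ _ (bXY M) _ IXX; have ZIY := integrableRZ _ (bYX M) _ IYY.
rewrite RexpB ?RexpZ//; last exact: integrableRB.
rewrite RexpB ?RexpZ// /centered_moment => H.
by apply/eqP; rewrite -subr_eq0 opprD addrA H.
Qed.

(** If equality held for every event, E(Y R_Y | Z) would be constant, and Y R_Y would be
    uncorrelated with each Z_j. *)
Lemma assumptionA_witness M : valid_model M -> bXY M * bYX M = 0 ->
  assumptionA M ->
  exists2 A, <<s genZ M >> A &
    centered_moment M (eY M) (eY M) A != bXY M * centered_moment M (eX M) (eY M) A.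
Proof.
move=> V bc [_ _ _ [IW IWZ [j cov]]].
apply: contrapT => H; case/eqP: cov.
have LX := L2_eX _ V; have LY := L2_eY _ V; have LR := L2_RY _ V.
have LZ k := L2_Z _ V k.
have GZ := genZ_measurable _ V.
pose W x := Y M x * RY M x; pose m := \int[P M]_x W x.
(* Write Y = e_Y + gamma_Y^T Z. The regression part drops, [RY] being orthogonal to Z_k times the
   weight; the part with e_Y is the difference supposed to vanish. *)
have H0 A : <<s genZ M >> A -> \int[P M]_x (W x * centered_indic (P M) A x) = 0.
  move=> ZA; have mc := meas_wrt_centered_indic _ (P M) _ ZA.
  have mA := sigma_sub_measurable _ _ GZ ZA.
  have I1 := centered_moment_integrable _ _ _ _ V LY LR ZA.
  have I2 k := centered_moment_integrable _ _ _ _ V LR (LZ k) ZA.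
  have I3 k := integrableRZ _ (gammaY M k) _ (I2 k).
  rewrite (_ : \int[P M]_x _ = \int[P M]_x (
     eY M x * RY M x * centered_indic (P M) A x +
     \sum_k gammaY M k * (RY M x * Z M k x * centered_indic (P M) A x))); last first.
    apply: eq_Rintegral => x _.
    transitivity ((eY M x + \sum_k gammaY M k * Z M k x) * RY M x * centered_indic (P M) A x).
      by rewrite /eY subrK.
    rewrite !mulrDl !mulr_suml; congr (_ + _).
    by apply: eq_bigr => k _; ring.
  rewrite RexpD//; last exact: integrableR_sum.
  rewrite Rexp_sum// big1 ?addr0 => [|k _]; last first.
    have Ik := I2 k; rewrite RexpZ//.
    under eq_Rintegral do rewrite -mulrA.
    rewrite RY_orth ?mulr0//; first exact: meas_wrtM (meas_Z _ _) mc.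
    by move: Ik; congr integrableR; apply/funext => x; rewrite mulrA.
  have IXY := centered_moment_integrable _ _ _ _ V LX LY ZA.
  have IYY := centered_moment_integrable _ _ _ _ V LY LY ZA.
  rewrite (_ : \int[P M]_x _ = \int[P M]_x (
     eY M x * eY M x * centered_indic (P M) A x -
     bXY M * (eX M x * eY M x * centered_indic (P M) A x))); last first.
    by apply: eq_Rintegral => x _; rewrite RY_eY//; ring.
  rewrite RexpB ?RexpZ//; last exact: integrableRZ.
  apply/eqP; rewrite subr_eq0; apply: contrapT => /negP Hne.
  by apply: H; exists A.
(* By [H0], [f] integrates to zero over each event of sigma(Z), so [pull_out] can test it against
   the unbounded Z_j. *)
pose f x := W x - m.
have If : integrableR (P M) f by apply: integrableRB => //; exact: integrableR_cst.
have IfZ : integrableR (P M) (fun x => f x * Z M j x).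
  rewrite (_ : (fun x => _) = fun x => W x * Z M j x - m * Z M j x); last first.
    by apply/funext => x; rewrite mulrBl.
  by apply: integrableRB; [exact: IWZ|exact/integrableRZ/L2_integrable].
have fZ : \int[P M]_x (f x * Z M j x) = 0.
  apply: (pull_out _ _ _ _ GZ If _ (meas_Z _ j) IfZ) => A ZA.
  have mA := sigma_sub_measurable _ _ GZ ZA.
  have I1 : integrableR (P M) (fun x => W x * \1_A x).
    apply: (integrableR_bounded _ _ _ 1 IW); first exact: measurable_indic.
    exact: indic_norm_le1.
  have I2 : integrableR (P M) (\1_A).
    by apply: integrable_indic => //; rewrite -ge0_fin_numE// fin_num_measure.
  have := H0 A ZA.
  rewrite (_ : \int[P M]_x _ = \int[P M]_x (W x * \1_A x - fine (P M A) * W x)).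
    rewrite RexpB ?RexpZ//; last exact: integrableRZ.
    move=> E0; under eq_Rintegral do rewrite mulrBl.
    rewrite RexpB ?RexpZ//; last exact: integrableRZ.
    by rewrite Rexp_indic// mulrC.
  by apply: eq_Rintegral => x _; rewrite mulrBr [fine _ * _]mulrC.
rewrite unlock.
have Z0 : ('E_(P M)[Z M j] = 0)%E by case: V => [[_ _ []]].
have -> : (fine ('E_(P M)[Z M j])%E) = 0 by rewrite Z0.
rewrite unlock.
transitivity (\int[P M]_x (f x * Z M j x)%:E)%E.
  by apply: eq_integral => x _; rewrite -[Z M j x in RHS]subr0.
by rewrite -[LHS]fineK ?[fine _]fZ//; apply: integrable_fin_num => //; exact: IfZ.
Qed.

End residuals.

(** * Identification *)

Section identification.
Context {R : realType} {p : nat}.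
Implicit Type M : SEM R p.
Notation obsT := (R * R * ('I_p -> R))%type.

Lemma centered_moment_law M1 M2 (f g : obsT -> R) S :
  valid_model M1 -> valid_model M2 -> same_obs_law M1 M2 ->
  measurable_fun setT (f : g_sigma_algebraType (@obs_gen R p) -> R) ->
  measurable_fun setT (g : g_sigma_algebraType (@obs_gen R p) -> R) ->
  L2 (P M1) (f \o obs M1) -> L2 (P M1) (g \o obs M1) ->
  L2 (P M2) (f \o obs M2) -> L2 (P M2) (g \o obs M2) ->
  <<s @obs_genZ R p >> S ->
  centered_moment M1 (f \o obs M1) (g \o obs M1) (obs M1 @^-1` S) =
  centered_moment M2 (f \o obs M2) (g \o obs M2) (obs M2 @^-1` S).
Proof.
move=> V1 V2 law mf mg f1 g1 f2 g2 ZS.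
have GS : <<s @obs_gen R p >> S.
  apply: smallest_sub ZS; first exact: smallest_sigma_algebra.
  by move=> A HA; apply: sub_sigma_algebra; right.
have mS : measurable_fun setT (\1_S : g_sigma_algebraType (@obs_gen R p) -> R).
  by apply: measurable_indic.
have EP : P M1 (obs M1 @^-1` S) = P M2 (obs M2 @^-1` S) by exact: law.
(* The centring constant depends on the model only through the law, so one [F] serves both
   models. *)
pose F (o : obsT) := f o * g o * (\1_S o - fine (P M1 (obs M1 @^-1` S))).
have E1 x : (f \o obs M1) x * (g \o obs M1) x *
    centered_indic (P M1) (obs M1 @^-1` S) x =
  F (obs M1 x) by [].
have E2 x : (f \o obs M2) x * (g \o obs M2) x *
    centered_indic (P M2) (obs M2 @^-1` S) x =
  F (obs M2 x) by rewrite /centered_indic -EP.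
rewrite /centered_moment; under eq_Rintegral do rewrite E1.
under [RHS]eq_Rintegral do rewrite E2.
apply: (same_law_Rexp _ _ F V1 V2 law).
- apply: measurable_funM; first exact: measurable_funM.
  exact: measurable_funB.
- have := centered_moment_integrable _ _ _ _ V1 f1 g1 (sigmaZ_obs M1 _ ZS).
  by rewrite (funext E1).
- have := centered_moment_integrable _ _ _ _ V2 f2 g2 (sigmaZ_obs M2 _ ZS).
  by rewrite (funext E2).
Qed.

Lemma measurable_resid (h : obsT -> R) (a : 'I_p -> R) :
  measurable_fun setT (h : g_sigma_algebraType (@obs_gen R p) -> R) ->
  measurable_fun setT
    ((fun o : obsT => h o - \sum_j a j * o.2 j)
      : g_sigma_algebraType (@obs_gen R p) -> R).
Proof.
move=> mh; apply: measurable_funB => //; apply: measurable_sum => j.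
by apply: measurable_funM => //; exact: measurable_obsZ.
Qed.

(** With equal regression coefficients, the residuals are the same functions of the observation in
    both models. *)
Lemma centered_moment_eq M1 M2 S : valid_model M1 -> valid_model M2 ->
  same_obs_law M1 M2 -> gammaX M1 = gammaX M2 -> gammaY M1 = gammaY M2 ->
  <<s @obs_genZ R p >> S ->
  [/\ centered_moment M1 (eX M1) (eY M1) (obs M1 @^-1` S) =
        centered_moment M2 (eX M2) (eY M2) (obs M2 @^-1` S),
      centered_moment M1 (eX M1) (eX M1) (obs M1 @^-1` S) =
        centered_moment M2 (eX M2) (eX M2) (obs M2 @^-1` S)
    & centered_moment M1 (eY M1) (eY M1) (obs M1 @^-1` S) =
        centered_moment M2 (eY M2) (eY M2) (obs M2 @^-1` S)].
Proof.
move=> V1 V2 law EX EY ZS.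
pose fX (o : obsT) := o.1.1 - \sum_j gammaX M1 j * o.2 j.
pose fY (o : obsT) := o.1.2 - \sum_j gammaY M1 j * o.2 j.
have X1 : eX M1 = fX \o obs M1 by [].
have Y1 : eY M1 = fY \o obs M1 by [].
have X2 : eX M2 = fX \o obs M2 by rewrite /fX EX.
have Y2 : eY M2 = fY \o obs M2 by rewrite /fY EY.
have := L2_eX _ V1; have := L2_eX _ V2; have := L2_eY _ V1; have := L2_eY _ V2.
rewrite X1 X2 Y1 Y2 => *.
have mX := measurable_resid _ (gammaX M1) measurable_obsX.
have mY := measurable_resid _ (gammaY M1) measurable_obsY.
by split; apply: centered_moment_law.
Qed.

Lemma assumptionA_swap M : assumptionA' M -> assumptionA (swap M).
Proof.
have gXE j : gammaX (swap M) j = gammaY M j by rewrite gammaX_swap.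
have VplE : @V_pl _ _ (swap M) = V_pl M by apply/setP => j; rewrite !inE andbC.
have SE : @S_X _ _ (swap M) = S_Y M by apply/setP => j; rewrite !inE gXE.
move=> [H1 H2 H3 H4]; split => //.
- move=> t; apply: leq_trans (H1 t); rewrite ltnS; apply: subset_leq_card.
  by apply/fintype.subsetP => j; rewrite !inE gXE [(_ != 0) && (_ != 0)]andbC.
- by rewrite VplE SE.
Qed.

(** Counts the indices whose ratio h_j / g_j is [t]; the product form suits the inversion
    [ratio_countV]. *)
Definition ratio_count (g h : 'I_p -> R) (t : R) : nat :=
  #|[set j | (g j != 0) && (h j == t * g j)]%SET|.

Lemma ratio_countV g h t : t != 0 -> ratio_count g h t = ratio_count h g t^-1.
Proof.
move=> t0; apply: eq_card => j; rewrite !inE.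
apply/andP/andP => -[gj /eqP E]; split.
- by rewrite E mulf_neq0.
- by rewrite E mulKf.
- by apply: contra_neq gj => gj; rewrite -[h j](mulVKf t0) -E gj mulr0.
- by rewrite E mulVKf.
Qed.

(** As pi_Y = gamma_Y - b gamma_X, ratio [t] means pi_Y,j = (t - b) gamma_X,j. For t = b this
    selects [V_XY]; each other count is bounded by a competitor in Assumption A. The second claim
    compares [V_XY] with indices where gamma_X,j = 0. *)
Lemma assumptionA_mode M : bXY M * bYX M = 0 -> assumptionA M ->
  (forall t, t != bXY M -> (ratio_count (gammaX M) (gammaY M) t <
     ratio_count (gammaX M) (gammaY M) (bXY M))%N) /\
  (bYX M != 0 -> (ratio_count (gammaY M) (gammaX M) 0 <
     ratio_count (gammaX M) (gammaY M) (bXY M))%N).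
Proof.
move=> bc [H1 H2 H3 _].
have gX := gammaXE _ bc; have gY := gammaYE _ bc.
have pY j : gammaY M j = piY M j + bXY M * gammaX M j.
  by rewrite gX gY mulrDr mulrA bc mul0r addr0.
have VE : ratio_count (gammaX M) (gammaY M) (bXY M) = #|@V_XY _ _ M|.
  apply: eq_card => j; rewrite !inE pY.
  have -> : (piY M j + bXY M * gammaX M j == bXY M * gammaX M j) = (piY M j == 0).
    by rewrite -subr_eq0 addrK.
  by case: (eqVneq (piY M j) 0) => [p0|_]; rewrite ?andbF// gX p0 mulr0 addr0.
rewrite VE; split => [t tb|c0].
  have pYt j : gammaY M j = t * gammaX M j -> piY M j = (t - bXY M) * gammaX M j.
    by move=> E; rewrite mulrBl -E pY addrK.
  have tb0 : t - bXY M != 0 by rewrite subr_eq0.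
  (* Here pi_X,j = (1 - c (t - b)) gamma_X,j: the indices lie in [V_YX] if c (t - b) = 1, and
     otherwise in [V_pl] and [S_X] with ratio t - b. *)
  have [ct|ct] := eqVneq (bYX M * (t - bXY M)) 1.
    have c0 : bYX M != 0.
      by apply/eqP => c0; move/eqP: ct; rewrite c0 mul0r eq_sym oner_eq0.
    apply: leq_ltn_trans H2; rewrite c0 muln1; apply: subset_leq_card.
    apply/fintype.subsetP => j; rewrite !inE => /andP[g0 /eqP /pYt E].
    rewrite E mulf_neq0//=; have := gX j; rewrite E mulrA ct mul1r.
    by move=> /eqP; rewrite -subr_eq subrr eq_sym.
  apply: leq_ltn_trans (H1 (t - bXY M)); apply: subset_leq_card.
  apply/fintype.subsetP => j; rewrite !inE => /andP[g0 /eqP /pYt E].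
  rewrite g0 E mulf_neq0// mulfK// eqxx !andbT.
  apply: contra_neq ct => p0; have := gX j; rewrite p0 add0r E mulrA => E'.
  by apply: (mulIf g0); rewrite -E' mul1r.
(* With gamma_X,j = 0, pi_Y,j = gamma_Y,j is nonzero, and hence so is pi_X,j = - c pi_Y,j. *)
apply: leq_ltn_trans H3; rewrite c0 muln1; apply: subset_leq_card.
apply/fintype.subsetP => j; rewrite !inE => /andP[g0 /eqP]; rewrite mul0r => E.
have p0 : piY M j != 0 by move: g0; rewrite pY E mulr0 addr0.
rewrite E eqxx p0 andbT /=; apply/eqP => p1.
by move: E; rewrite gX p1 add0r => /eqP; rewrite mulf_eq0 (negbTE c0) (negbTE p0).
Qed.

Lemma ident_AA M1 M2 : valid_model M1 -> valid_model M2 ->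
  assumptionA M1 -> assumptionA M2 ->
  bXY M1 * bYX M1 = 0 -> bXY M2 * bYX M2 = 0 -> same_obs_law M1 M2 ->
  bXY M1 = bXY M2 /\ bYX M1 = bYX M2.
Proof.
move=> V1 V2 A1 A2 bc1 bc2 law.
have EX := gammaX_law _ _ V1 V2 bc1 bc2 law.
have EY := gammaY_law _ _ V1 V2 bc1 bc2 law.
have [m1 _] := assumptionA_mode _ bc1 A1.
have [m2 _] := assumptionA_mode _ bc2 A2.
have bE : bXY M1 = bXY M2.
  apply/eqP; apply/negPn/negP => ne.
  have ne' : bXY M2 != bXY M1 by rewrite eq_sym.
  have := m2 _ ne; rewrite -EX -EY => /(ltn_trans (m1 _ ne')).
  by rewrite ltnn.
split => //.
(* A nonzero b forces c = 0 in both models. If b = 0, the relation reads E(e_X e_Y w) = c E(e_Y^2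
   w), and the witness makes the coefficient of c nonzero. *)
have [b0|b0] := eqVneq (bXY M1) 0; last first.
  have b0' : bXY M2 != 0 by rewrite -bE.
  move/eqP: bc1; rewrite mulf_eq0 (negbTE b0) => /eqP ->.
  by move/eqP: bc2; rewrite mulf_eq0 (negbTE b0') => /eqP ->.
have [A ZA] := assumptionA_witness _ V1 bc1 A1.
have [S ZS AS] := obs_sigmaZ _ _ ZA.
have := centered_moment_relation _ _ V2 bc2 (sigmaZ_obs M2 _ ZS).
have := centered_moment_relation _ _ V1 bc1 ZA; rewrite AS.
have [-> -> ->] := centered_moment_eq _ _ _ V1 V2 law EX EY ZS.
rewrite -bE b0 !mul0r !addr0 => -> /eqP + r0.
by move=> /eqP /(mulIf r0).
Qed.

Lemma ident_AA' M1 M2 : valid_model M1 -> valid_model M2 ->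
  assumptionA M1 -> assumptionA' M2 ->
  bXY M1 * bYX M1 = 0 -> bXY M2 * bYX M2 = 0 -> same_obs_law M1 M2 ->
  bXY M1 = bXY M2 /\ bYX M1 = bYX M2.
Proof.
move=> V1 V2 A1 /assumptionA_swap A2 bc1 bc2 law.
have EX := gammaX_law _ _ V1 V2 bc1 bc2 law.
have EY := gammaY_law _ _ V1 V2 bc1 bc2 law.
have cb2 : bXY (swap M2) * bYX (swap M2) = 0 by rewrite /= mulrC.
have [m1 n1] := assumptionA_mode _ bc1 A1.
have [m2 n2] := assumptionA_mode _ cb2 A2.
rewrite /= gammaX_swap gammaY_swap -EX -EY in m2 n2.
have rel1 A (ZA : <<s genZ M1 >> A) := centered_moment_relation _ _ V1 bc1 ZA.
(* The relation of [M2] and, below, its witness are transported to events of [M1], where they meet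
   those of [M1]. *)
have rel2 A : <<s genZ M1 >> A ->
    centered_moment M1 (eX M1) (eY M1) A = bYX M2 * centered_moment M1 (eY M1) (eY M1) A
                                + bXY M2 * centered_moment M1 (eX M1) (eX M1) A.
  move=> /obs_sigmaZ[S ZS ->].
  have [-> -> ->] := centered_moment_eq _ _ _ V1 V2 law EX EY ZS.
  by apply: centered_moment_relation => //; exact: sigmaZ_obs.
have [A1' ZS1 w1] := assumptionA_witness _ V1 bc1 A1.
have [A2' ZS2 w2] : exists2 A, <<s genZ M1 >> A &
    centered_moment M1 (eX M1) (eX M1) A != bYX M2 * centered_moment M1 (eX M1) (eY M1) A.
  have [A ZA] := assumptionA_witness _ (swap_valid _ V2) cb2 A2.
  have [S ZS ->] := obs_sigmaZ M2 _ ZA; rewrite eX_swap eY_swap => w.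
  exists (obs M1 @^-1` S); first exact: sigmaZ_obs.
  have [-> -> _] := centered_moment_eq _ _ _ V1 V2 law EX EY ZS.
  move: w; congr (is_true (_ != _ * _)).
  by apply: eq_Rintegral => x _; rewrite [X in X * _]mulrC.
move: (rel1 _ ZS1) (rel2 _ ZS1) (rel1 _ ZS2) (rel2 _ ZS2) w1 w2.
do 3 move: (centered_moment _ _ _ A1').
do 3 move: (centered_moment _ _ _ A2').
move: m1 n1 m2 n2 bc1 bc2.
move: (bXY M1) (bYX M1) (bXY M2) (bYX M2) => b1 c1 b2 c2.
(* Only real numbers remain: [q], [r], [s] are the moments of e_X e_Y, e_Y^2, e_X^2, with suffix 1
   at the witness of [M1] and 2 at that of [M2]. *)
move=> m1 n1 m2 n2 bc1 bc2 s2 r2 q2 s1 r1 q1 e11 e12 e21 e22 w1 w2.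
have [b1_0|b1_0] := eqVneq b1 0; have [c2_0|c2_0] := eqVneq c2 0.
- subst b1 c2.
  have [c1_0|c1_0] := eqVneq c1 0; have [b2_0|b2_0] := eqVneq b2 0.
  + by subst.
  + subst c1; case/eqP: w2; rewrite mul0r.
    by move: e22; rewrite e21 !mul0r !add0r => /esym/eqP;
      rewrite mulf_eq0 (negbTE b2_0) => /eqP.
  + subst b2; case/eqP: w1; rewrite mul0r.
    by move: e11; rewrite e12 !mul0r !addr0 => /esym/eqP;
      rewrite mulf_eq0 (negbTE c1_0) => /eqP.
  (* Both modes are at ratio 0, and each of the two counts would strictly exceed the other. *)
  + by have := ltn_trans (n1 c1_0) (n2 b2_0); rewrite ltnn.
- subst b1; have b2_0 : b2 = 0.
    by move/eqP: bc2; rewrite mulf_eq0 (negbTE c2_0) orbF => /eqP.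
  subst b2; split => //; move: w1; rewrite mul0r => r0.
  by apply: (mulIf r0); move: e11; rewrite e12 !mul0r !addr0.
- subst c2; have c1_0 : c1 = 0.
    by move/eqP: bc1; rewrite mulf_eq0 (negbTE b1_0) => /eqP.
  subst c1; split => //; move: w2; rewrite mul0r => s0.
  by apply: (mulIf s0); move: e21; rewrite e22 !mul0r !add0r.
have c1_0 : c1 = 0.
  by move/eqP: bc1; rewrite mulf_eq0 (negbTE b1_0) => /eqP.
have b2_0 : b2 = 0.
  by move/eqP: bc2; rewrite mulf_eq0 (negbTE c2_0) orbF => /eqP.
subst c1 b2; exfalso.
(* Inversion of ratios carries the mode [c2] of gamma_X / gamma_Y to a mode of gamma_Y / gamma_X
   among nonzero ratios, which must be [b1]. *)
have b1E : b1 = c2^-1.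
  apply/eqP; apply/negPn/negP => ne.
  have := m1 c2^-1; rewrite eq_sym => /(_ ne).
  rewrite ratio_countV ?invr_eq0// invrK (ratio_countV _ _ b1)//.
  have /m2 H : b1^-1 != c2 by apply: contra_neq ne => <-; rewrite invrK.
  by move=> /(ltn_trans H); rewrite ltnn.
(* The relation of [M2] gives [q1 = c2 r1], so [b1 q1 = r1], against the witness. *)
case/eqP: w1; move: e12; rewrite mul0r addr0 => ->.
by rewrite b1E mulKf.
Qed.

End identification.

(* Identifiability: within the class of models satisfying the standing
   assumptions, (Assumption A or A'), and beta_XY * beta_YX = 0, the pair
   (beta_XY, beta_YX) is determined by the joint law of (X, Y, Z). *)
Theorem theorem2 (R : realType) (p : nat) (M1 M2 : SEM R p) :
  valid_model M1 -> valid_model M2 ->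
  (assumptionA M1 \/ assumptionA' M1) ->
  (assumptionA M2 \/ assumptionA' M2) ->
  bXY M1 * bYX M1 = 0 -> bXY M2 * bYX M2 = 0 ->
  same_obs_law M1 M2 ->
  bXY M1 = bXY M2 /\ bYX M1 = bYX M2.
Proof.
move=> V1 V2 [A1|A1] [A2|A2] bc1 bc2 law.
- exact: ident_AA.
- exact: ident_AA'.
- have law' : same_obs_law M2 M1 by move=> S HS; rewrite law.
  by have [-> ->] := ident_AA' _ _ V2 V1 A2 A1 bc2 bc1 law'.
- have := ident_AA _ _ (swap_valid _ V1) (swap_valid _ V2)
    (assumptionA_swap _ A1) (assumptionA_swap _ A2).
  rewrite /= [bYX M1 * _]mulrC [bYX M2 * _]mulrC.
  by move=> /(_ bc1 bc2 (same_law_swap _ _ law)) [-> ->].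
Qed.
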